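(* Let $G$ be a finite, simple, connected graph which is not a path, not a cycle, and not the graph $K_{1,3}$. Then there exist uncountably many evasive walks on $G$.
   Context: $K_{1,3}$ is the graph with one vertex of degree $3$ joined to three vertices of degree $1$. A walk on $G$ is an infinite sequence $R(1),R(2),\ldots$ of vertices with $R(i)$ adjacent to $R(i+1)$ for all $i$. A random walk on $G$: $R(1)$ uniform among vertices, each $R(i+1)$ uniform among neighbours of $R(i)$. For walks $R,S$, tokens $T_R,T_S$ start at $R(1),S(1)$; a move advances exactly one token one step along its own walk. The pair $(R,S)$ is successful if there is an infinite sequence of moves in which each token is advanced infinitely often and the tokens never occupy the same vertex simultaneously (including initially). A walk $S$ is evasive if for a random walk $R$ on $G$, $(R,S)$ is successful with positive probability. *)

(* Defs.v *)
From HB Require Import structures.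
From mathcomp Require Import all_boot all_order all_algebra.
From mathcomp Require Import all_classical all_reals all_analysis.

Set Implicit Arguments.
Unset Strict Implicit.
Unset Printing Implicit Defensive.

Import Order.TTheory GRing.Theory Num.Theory.
Local Open Scope classical_set_scope.
Local Open Scope ring_scope.

(* A graph with vertex set T is given by its adjacency relation e : rel T. *)
Definition simple_graph (T : finType) (e : rel T) : Prop :=
  symmetric e /\ irreflexive e.

(* The graph without vertices is not counted as connected. *)
Definition connected_graph (T : finType) (e : rel T) : Prop :=
  (0 < #|T|)%N /\ forall x y : T, connect e x y.

Definition graph_isomorphic (T U : finType) (e : rel T) (e' : rel U) : Prop :=
  exists2 f : T -> U, bijective f & forall x y, e' (f x) (f y) = e x y.

Definition path_rel (n : nat) : rel 'I_n :=
  fun i j => ((val i).+1 == val j) || ((val j).+1 == val i).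

Definition cycle_rel (n : nat) : rel 'I_n :=
  fun i j => ((val i).+1 %% n == val j)%N || ((val j).+1 %% n == val i)%N.

(* K_{1,3}: the vertex 0 is the centre. *)
Definition claw_rel : rel 'I_4 :=
  fun i j => (i == ord0) (+) (j == ord0).

(* A single vertex is the path with n = 1. *)
Definition is_path_graph (T : finType) (e : rel T) : Prop :=
  exists n : nat, graph_isomorphic e (@path_rel n).

Definition is_cycle_graph (T : finType) (e : rel T) : Prop :=
  exists2 n : nat, (3 <= n)%N & graph_isomorphic e (@cycle_rel n).

Definition is_claw (T : finType) (e : rel T) : Prop :=
  graph_isomorphic e claw_rel.

(* Walks are indexed from 0. *)
Definition is_walk (T : finType) (e : rel T) (w : nat -> T) : Prop :=
  forall i : nat, e (w i) (w i.+1).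

Definition degree (T : finType) (e : rel T) (x : T) : nat := #|[pred y | e x y]|.

(* The law of the process X: X 0 is uniform, and, conditionally on
   X 0, ..., X n, X n.+1 is uniform among the neighbours of X n. *)
Definition random_walk (T : finType) (e : rel T) (R : realType)
    (d : measure_display) (Omega : measurableType d) (P : probability Omega R)
    (X : nat -> Omega -> T) : Prop :=
  [/\ forall (n : nat) (x : T), measurable [set om | X n om = x],
      forall x : T, P [set om | X 0%N om = x] = ((#|T|%:R)^-1)%:E
    & forall (n : nat) (w : nat -> T),
        P [set om | forall i : nat, (i <= n.+1)%N -> X i om = w i] =
        (P [set om | forall i : nat, (i <= n)%N -> X i om = w i] *
         (if e (w n) (w n.+1) then ((degree e (w n))%:R)^-1 else 0)%:E)%E].

(* A sequence of moves m : nat -> bool advances the first token at time k if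
   m k is true, and the second one otherwise. *)
Definition advances1 (m : nat -> bool) (k : nat) : nat := (\sum_(i < k) m i)%N.
Definition advances2 (m : nat -> bool) (k : nat) : nat :=
  (\sum_(i < k) ~~ m i)%N.

Definition successful (T : finType) (r s : nat -> T) : Prop :=
  exists m : nat -> bool,
    [/\ forall k : nat, exists2 i : nat, (k <= i)%N & m i,
        forall k : nat, exists2 i : nat, (k <= i)%N & ~~ m i
      & forall k : nat, r (advances1 m k) <> s (advances2 m k)].

(* As an existential over sequences of moves, the event that (X, S) is
   successful is not obviously measurable; its having positive probability
   means that it contains a measurable event of positive probability.  Whether
   this holds depends only on the law of the random walk, hence not on the
   choice of Omega, P and X. *)
Definition evasive (T : finType) (e : rel T) (R : realType)
    (S : nat -> T) : Prop :=
  is_walk e S /\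
  forall (d : measure_display) (Omega : measurableType d)
    (P : probability Omega R) (X : nat -> Omega -> T),
    random_walk e P X ->
    exists A : set Omega,
      [/\ measurable A,
          A `<=` [set om | successful (fun n => X n om) S]
        & (0 < P A)%E].

(* Main.v *)
(* While the first token rests at a vertex p, a second walk confined to a vertex
   set H not containing p may be advanced at will.  Choose the second walk S so
   that it runs through every finite walk of H infinitely often.  If every
   excursion of the first walk from p can be dodged by some walk inside H, then,
   at each visit to p, S is advanced to an occurrence of the finite walk that
   dodges the excursion to come; as the random walk starts at p with positive
   probability and returns to p infinitely often almost surely, S is evasive.
   Such walks S can be built so as to differ from any given sequence of walks.

   Excursions can be dodged inside a triangle (when the first token is about to
   step on the second one, the latter moves to the third vertex), and inside a
   claw: the second token rests at leaves, and switches to another leaf through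
   the centre, while the first token is not there, so that it is neither at the
   next vertex y of the first walk nor, when y is the centre, at the vertex that
   follows y.  A connected graph that is neither a path nor a cycle has a vertex
   of degree at least 3; either some vertex lies outside of the claw around it,
   or the graph has four vertices and is the claw or contains a triangle. *)

Require Import Defs.
From mathcomp Require Import all_boot all_order all_algebra.
From mathcomp Require Import all_classical all_reals all_analysis.
From mathcomp Require Import zify lra.

Set Implicit Arguments.
Unset Strict Implicit.
Unset Printing Implicit Defensive.

Import Order.TTheory GRing.Theory Num.Theory.

Local Open Scope nat_scope.

(** * Schedules *)

(* [a i] is the index of the second token when the first one arrives at index [i]. *)
Lemma schedule_successful (T : finType) (r s : nat -> T) (a : nat -> nat) :
  a 0 = 0 -> (forall i, a i <= a i.+1) -> (forall N, exists i, N <= a i) ->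
  (forall i t, a i <= t <= a i.+1 -> r i <> s t) -> successful r s.
Proof.
move=> a0 a_mono a_unbounded rs.
(* The pair [st k] holds the positions of both tokens after [k] moves: the second token advances up
   to index [a i.+1], and only then does the first one step from [i] to [i.+1]. *)
pose st := fix st k := if k is k'.+1 then
    let ij := st k' in
    if ij.2 == a ij.1.+1 then (ij.1.+1, ij.2) else (ij.1, ij.2.+1)
  else (0, 0).
pose m k := (st k).2 == a (st k).1.+1.
have stS k : st k.+1 = if m k then ((st k).1.+1, (st k).2)
                       else ((st k).1, (st k).2.+1) by [].
have st_adv k : st k = (advances1 m k, advances2 m k).
  elim: k => [|k IHk]; first by rewrite /advances1 /advances2 !big_ord0.
  rewrite stS /advances1 /advances2 !big_ord_recr /= -/(advances1 m k).
  rewrite -/(advances2 m k) IHk /=.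
  by case: (m k); rewrite ?addn0 ?addn1.
have st_range k : a (st k).1 <= (st k).2 <= a (st k).1.+1.
  elim: k => [|k IHk]; first by rewrite /= a0 /=.
  rewrite stS /m; case: eqP => [E|/eqP ne] /=; first by rewrite E leqnn a_mono.
  by case/andP: IHk => l1 l2; rewrite leqW //= ltn_neqAle ne.
exists m; split=> [k|k|k].
(* If only the second token moved from time [k] on, its index would exceed [a (st k).1.+1], against
   [st_range]. *)
- have [//|no_true] := pselect (exists2 i, k <= i & m i).
  have stuck n : st (k + n) = ((st k).1, (st k).2 + n).
    elim: n => [|n IHn]; first by rewrite !addn0; case: (st k).
    rewrite addnS stS ifN; first by rewrite IHn /= addnS.
    by apply/negP => mi; apply: no_true; exists (k + n) => //; exact: leq_addr.
  have := st_range (k + (a (st k).1.+1).+1).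
  by rewrite stuck /= => /andP[_]; rewrite addnS ltnNge leq_addl.
- have [//|no_false] := pselect (exists2 i, k <= i & ~~ m i).
  have stuck n : st (k + n) = ((st k).1 + n, (st k).2).
    elim: n => [|n IHn]; first by rewrite !addn0; case: (st k).
    rewrite addnS stS ifT; first by rewrite IHn /= addnS.
    by apply/negPn/negP => mi; apply: no_false; exists (k + n); rewrite ?leq_addr.
  have [i lt_i] := a_unbounded (st k).2.+1.
  have a_le : {homo a : x y / x <= y}.
  by apply: homo_leq a_mono; [exact: leqnn | exact: leq_trans].
  have := st_range (k + i); rewrite stuck /= => /andP[le_i _].
  by have := leq_trans lt_i (leq_trans (a_le _ _ (leq_addl _ _)) le_i); rewrite ltnn.
- by have := st_range k; rewrite st_adv => /= /rs.
Qed.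

(** A finite plan for [n] steps of the first token, ending at [p]: [j] is the index of the second
    token when the first one arrives at index [i], and [j'] its index when the first one leaves. The
    final position of the second token is left free. *)
Fixpoint evades_until (T : finType) (p : T) (r s : nat -> T) (n i j : nat) : Prop :=
  if n is n'.+1 then
    exists j', [/\ j <= j', forall t, j <= t <= j' -> r i <> s t
                 & evades_until p r s n' i.+1 j']
  else r i = p.

(** Plans are concatenated: at each visit to [p] the second token first runs ahead to [j'], where
    the next plan starts. The plan has [n.+1] steps because it begins with the first token still at
    [p]. *)
Lemma evades_successful (T : finType) (p : T) (r s : nat -> T) :
  r 0 = p -> (forall N, exists2 i, N <= i & r i = p) ->
  (forall i j, r i = p ->
    exists n j', [/\ j < j', forall t, j <= t <= j' -> s t <> p
                   & evades_until p r s n.+1 i j']) ->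
  successful r s.
Proof.
move=> r0 r_p skip.
pose good i j := exists n, evades_until p r s n i j.
have step i j : good i j -> exists j',
    [/\ j <= j', r i = p -> j < j', forall t, j <= t <= j' -> r i <> s t
      & good i.+1 j'].
  move=> [n ev]; have [rip|rip] := pselect (r i = p).
    have [n' [j1 [lt_j j1P [j2 [le_j2 j2P ev']]]]] := skip i j rip.
    exists j2; split => //; [lia|lia| |by exists n'].
    move=> t /andP[jt tj]; case: (leqP j1 t) => [j1t|/ltnW tj1].
      by apply: j2P; rewrite j1t.
    by rewrite rip => /esym; apply: j1P; rewrite jt.
  case: n ev => [//|n] /= [j' [le_j' j'P ev']].
  by exists j'; split => //; exists n.
have good0 : good 0 0 by exists 0.
have next (x : {ij : nat * nat | good ij.1 ij.2}) :
    {y : {ij : nat * nat | good ij.1 ij.2} |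
     [/\ (sval y).1 = (sval x).1.+1, (sval x).2 <= (sval y).2,
         r (sval x).1 = p -> (sval x).2 < (sval y).2
       & forall t, (sval x).2 <= t <= (sval y).2 -> r (sval x).1 <> s t]}.
  apply: cid; case: x => [[i j] /= /step[j' [le_j' lt_j' j'P gd]]].
  by exists (exist _ (i.+1, j') gd).
pose st k := iter k (fun x => sval (next x)) (exist _ (0, 0) good0).
pose a k := (sval (st k)).2.
have stS k : [/\ (sval (st k.+1)).1 = (sval (st k)).1.+1, a k <= a k.+1,
    r (sval (st k)).1 = p -> a k < a k.+1
  & forall t, a k <= t <= a k.+1 -> r (sval (st k)).1 <> s t].
  exact: svalP (next (st k)).
have st1 k : (sval (st k)).1 = k.
  by elim: k => [//|k IHk]; case: (stS k) => -> _ _ _; rewrite IHk.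
have aS k : [/\ a k <= a k.+1, r k = p -> a k < a k.+1
              & forall t, a k <= t <= a k.+1 -> r k <> s t].
  by have := stS k; rewrite !st1 => -[].
apply: (@schedule_successful _ _ _ a) => // [i|N|i]; try by case: (aS i).
(* The index of the second token is unbounded because it strictly increases at each of the
   infinitely many visits to [p]. *)
elim: N => [|N [i le_N]]; first by exists 0.
have [i' le_i r_i'] := r_p i.
have [_ /(_ r_i') lt_a _] := aS i'.
exists i'.+1; apply: leq_ltn_trans lt_a; apply: leq_trans le_N _.
have a_mono k : a k <= a k.+1 by case: (aS k).
have a_le : {homo a : x y / x <= y}.
  by apply: homo_leq a_mono; [exact: leqnn | exact: leq_trans].
exact: a_le.
Qed.

Definition induced_edge (T : finType) (H : seq T) (e : rel T) : rel T :=
  fun x y => [&& x \in H, y \in H & e x y].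

(* [I x y u]: with the first token at [x] and about to move to [y], the second
   one may be at [u]. *)
Definition dodging (T : finType) (e : rel T) (H : seq T)
    (I : T -> T -> T -> Prop) : Prop :=
  forall x y z u, I x y u -> e x y -> e y z ->
    exists s, [/\ path (induced_edge H e) u s, x \notin u :: s & I y z (last u s)].

Definition reads (T : eqType) (w : seq T) (s : nat -> T) (j : nat) : Prop :=
  forall x0 t, t < size w -> s (j + t) = nth x0 w t.

(** The replies given by [dodging] to successive steps of [r] are concatenated. The resulting word
    depends on [r] alone, so it serves at every place where a second walk happens to read it. *)
Lemma dodging_word (T : finType) (e : rel T) (H : seq T) I (p : T) (r : nat -> T) :
  dodging e H I -> is_walk e r -> forall n i u, I (r i) (r i.+1) u -> r (i + n) = p ->
  exists2 w, path (induced_edge H e) u w &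
    forall s j, reads (u :: w) s j -> evades_until p r s n i j.
Proof.
move=> dI r_walk; elim=> [|n IHn] i u Iu rp.
  by exists [::] => //= s j _; rewrite -rp addn0.
have [w1 [w1_path r_w1 Iw1]] := dI _ _ _ _ Iu (r_walk i) (r_walk i.+1).
have [|w2 w2_path w2P] := IHn _ _ Iw1; first by rewrite addSnnS.
exists (w1 ++ w2) => [|s j s_reads /=]; first by rewrite cat_path w1_path.
exists (j + size w1); split; first exact: leq_addr.
- move=> t /andP[jt tj] r_s; move/negP: r_w1; apply; rewrite r_s -(subnKC jt).
  have lt_t : t - j < size (u :: w1) by rewrite /=; lia.
  rewrite (s_reads u); last by rewrite /= size_cat /= in lt_t *; lia.
  by rewrite -cat_cons nth_cat lt_t mem_nth.
(* The last letter of [u :: w1] is also the first letter of the word for the remaining steps, hence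
   the separate case [t = 0]. *)
- apply: w2P => x0 t lt_t; rewrite -addnA (s_reads x0); last first.
    by move: lt_t; rewrite /= size_cat; lia.
  case: t lt_t => [|t] lt_t.
    rewrite addn0 -cat_cons nth_cat /= ltnSn.
    by rewrite (set_nth_default u) //= nth_last.
  rewrite addnS /= nth_cat ifN; last by rewrite -leqNgt leq_addr.
  by rewrite addKn.
Qed.

Lemma universal_successful (T : finType) (e : rel T) (H : seq T) I (p : T)
    (r s : nat -> T) :
  dodging e H I -> (forall y, exists2 u, u \in H & I p y u) -> p \notin H ->
  is_walk e r -> r 0 = p -> (forall N, exists2 i, N <= i & r i = p) ->
  (forall i, s i \in H) ->
  (forall u w N, u \in H -> path (induced_edge H e) u w ->
     exists2 j, N <= j & reads (u :: w) s j) ->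
  successful r s.
Proof.
move=> dI I0 pH r_walk r0 r_p sH s_univ; apply: evades_successful (r0) (r_p) _ => i j ri.
have [i' lt_i ri'] := r_p i.+1.
have [u uH Iu] := I0 (r i.+1); rewrite -{1}ri in Iu.
(* The excursion from [i] to the next chosen visit [i'] has [i' - i] steps, written as a successor.
   Its word is then sought after [j], which makes the advance strict. *)
have [|w w_path wP] := dodging_word (p := p) (n := (i' - i.+1).+1) dI r_walk Iu.
  by rewrite -ri' addnS -addSn subnKC.
have [j' lt_j s_reads] := s_univ u w j.+1 uH w_path.
exists (i' - i.+1), j'; split=> //; last exact: wP.
by move=> t _ st; move: pH; rewrite -st sH.
Qed.

(** * Universal walks *)

(** A Baire category argument: each [D k] is dense among the finite sequences satisfying [Q],
    ordered by extension, so a chain of extensions meets them all. The nonempty [q] makes the chain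
    converge to an infinite sequence. *)
Lemma generic_sequence (T : Type) (x0 : T) (Q : seq T -> Prop) (D : nat -> seq T -> Prop) :
  (exists p, Q p) ->
  (forall k p, Q p -> exists q, [/\ 0 < size q, Q (p ++ q) & D k (p ++ q)]) ->
  exists s, forall k, exists n, [/\ k < n, Q (mkseq s n) & D k (mkseq s n)].
Proof.
move=> [p0 Qp0] ext.
have next k (p : {p | Q p}) : {p' : {p | Q p} |
    exists q, [/\ 0 < size q, sval p' = sval p ++ q & D k (sval p')]}.
  apply: cid; case: (ext k _ (svalP p)) => q [q_gt0 Qq Dq].
  by exists (exist _ (sval p ++ q) Qq), q.
pose st := fix st k := if k is k'.+1 then sval (next k' (st k')) else exist _ p0 Qp0.
pose ps k := sval (st k).
have psS k : exists q, [/\ 0 < size q, ps k.+1 = ps k ++ q & D k (ps k.+1)].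
  exact: (svalP (next k (st k))).
have ps_size k : k <= size (ps k).
  elim: k => [//|k IHk]; have [q [q_gt0 -> _]] := psS k.
  by rewrite size_cat; lia.
have ps_ext k l : exists q, ps (k + l) = ps k ++ q.
  elim: l => [|l [q IHl]]; first by exists [::]; rewrite addn0 cats0.
  have [q' [_ E _]] := psS (k + l).
  by exists (q ++ q'); rewrite addnS E IHl catA.
(* The prefix [ps n.+1] has more than [n] entries, so the default [x0] is never returned. *)
pose s n := nth x0 (ps n.+1) n.
have psE k : ps k = mkseq s (size (ps k)).
  apply: (@eq_from_nth _ x0); first by rewrite size_mkseq.
  move=> i lt_i; rewrite nth_mkseq // /s.
  have [le_k|/ltnW lt_k] := leqP k i.+1.
    have [q] := ps_ext k (i.+1 - k).
    by rewrite subnKC // => ->; rewrite nth_cat lt_i.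
  have [q] := ps_ext i.+1 (k - i.+1).
  by rewrite subnKC // => ->; rewrite nth_cat ps_size.
exists s => k; exists (size (ps k.+1)).
by rewrite -psE ps_size; split => //; [exact: svalP (st k.+1) | case: (psS k) => q []].
Qed.

(** A generic walk in [H]: connectedness allows any finite walk to be appended, and the two
    neighbours [a] and [b] of [h] leave a choice with which to depart from [bad k]. *)
Lemma universal_walk_avoiding (T : finType) (e : rel T) (H : seq T) (h a b : T)
    (bad : nat -> nat -> T) :
  (forall x y, x \in H -> y \in H -> connect (induced_edge H e) x y) ->
  a != b -> induced_edge H e h a -> induced_edge H e h b ->
  exists s : nat -> T,
    [/\ is_walk e s, forall i, s i \in H,
        forall u w N, u \in H -> path (induced_edge H e) u w ->
          exists2 j, N <= j & reads (u :: w) s j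
      & forall k, s <> bad k].
Proof.
set g := induced_edge H e => g_conn ab ha hb.
have hH : h \in H by case/and3P: ha.
have aH : a \in H by case/and3P: ha.
have bH : b \in H by case/and3P: hb.
have g_in x c : x \in H -> path g x c -> all (mem H) c.
  elim: c x => [//|y c IHc] x xH /= /andP[/and3P[_ yH _] /(IHc _ yH) ->].
  by rewrite andbT.
(* Arbitrary length is gained by repeated detours through the edge from [h] to [a]. *)
have steer N x y : x \in H -> y \in H -> exists c, [/\ path g x c, N <= size c & last x c = y].
  elim: N x => [|N IHN] x xH yH.
    by have /connectP[c c_path ->] := g_conn x y xH yH; exists c.
  have [c [c_path c_size c_last]] := IHN a aH yH.
  have /connectP[c' c'_path hE] := g_conn x h xH hH.
  exists (c' ++ a :: c); split.
  - by rewrite cat_path c'_path /= -hE ha c_path.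
  - by rewrite size_cat /=; lia.
  - by rewrite last_cat /= c_last.
pose Q p := [&& 0 < size p, sorted g p & all (mem H) p].
(* Each [k] codes a task: read [u :: w] at some index at least [N]. Invalid codes stand for a
   trivial task. *)
pose decode k : nat * T * seq T :=
  if unpickle k is Some (N, u, w) then
    if (u \in H) && path g u w then (N, u, w) else (0, h, [::])
  else (0, h, [::]).
pose D k (p : seq T) := p <> mkseq (bad k) (size p) /\
  let: (N, u, w) := decode k in
  exists j, [/\ N <= j, j + size (u :: w) <= size p & reads (u :: w) (nth h p) j].
have [|k p /and3P[p_gt0 p_path pH]|s sP] := @generic_sequence T h Q D.
- by exists [:: h]; rewrite /Q /= hH.
- case: p p_gt0 p_path pH => [//|x p] _ p_path pH.
  rewrite /= in p_path pH; case/andP: pH => xH pH.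
  have /allP/(_ _ (mem_last x p)) yH : all (mem H) (x :: p) by rewrite /= xH.
  rewrite /= in yH.
  have [c1 [c1_path _ c1_last]] := steer 0 _ _ yH hH.
  have [d [dH hd bad_d]] : exists d, [/\ d \in H, g h d &
      bad k (size ((x :: p) ++ c1)) != d].
    have [E|ne] := eqVneq (bad k (size ((x :: p) ++ c1))) a.
      by exists b; rewrite E.
    by exists a.
  have decodeP : (decode k).1.2 \in H /\ path g (decode k).1.2 (decode k).2.
    rewrite /decode; case: (unpickle k) => [[[N u] w]|] //.
    by case: ifP => [/andP[]|].
  rewrite /D; case: (decode k) decodeP => [[N u] w] [uH w_path]; rewrite /= in uH w_path.
  have [c2 [c2_path c2_size c2_last]] := steer N _ _ dH uH.
  have q_path : path g (last x p) (c1 ++ d :: c2 ++ w).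
    by rewrite cat_path c1_path /= c1_last hd cat_path c2_path c2_last.
  (* The extension goes to [h], differs from [bad k] at [d], reaches [u] by the long detour [c2],
     and then follows [w]. *)
  exists (c1 ++ d :: c2 ++ w); split.
  + by rewrite size_cat addnS.
  + by rewrite /Q /= cat_path p_path q_path xH all_cat pH (g_in _ _ yH q_path).
  split.
    set l := size ((x :: p) ++ c1) in bad_d.
    move=> bad_pq.
    have : nth d ((x :: p) ++ c1 ++ d :: c2 ++ w) l = bad k l.
      by rewrite bad_pq nth_mkseq // catA [in ltnRHS]size_cat /= addnS ltnS leq_addr.
    by rewrite catA nth_cat ltnn subnn /= => dE; rewrite -dE eqxx in bad_d.
  have E : (x :: p) ++ c1 ++ d :: c2 ++ w = ((x :: p) ++ c1 ++ belast d c2) ++ u :: w.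
    by rewrite -cat_cons (lastI d c2) c2_last cat_rcons -!catA.
  exists (size ((x :: p) ++ c1 ++ belast d c2)); rewrite E; split.
  + by rewrite !size_cat size_belast addnA (leq_trans c2_size) ?leq_addl.
  + by rewrite [in leqRHS]size_cat.
  + move=> x0 t lt_t; rewrite nth_cat ifN; last by rewrite -leqNgt leq_addr.
    by rewrite addKn; apply: set_nth_default.
have sg i : s i \in H /\ g (s i) (s i.+1).
  have [n [lt_n /and3P[_ /(sortedP h) s_sorted /allP s_all] _]] := sP i.+1.
  rewrite size_mkseq in s_sorted; split.
    by apply: s_all; apply: (map_f s); rewrite mem_iota /= add0n ltnW.
  by have := s_sorted i lt_n; rewrite !nth_mkseq // ltnW.
exists s; split=> [i|i|u w N uH w_path|k sk].
- by have [_ /and3P[]] := sg i.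
- by case: (sg i).
- have [k kE] : exists k, unpickle k = Some (N, u, w).
    by exists (pickle (N, u, w)); exact: pickleK.
  have [n [_ _ [_]]] := sP k.
  rewrite /decode kE uH w_path /= => -[j [le_j lt_j w_reads]].
  exists j => // x0 t lt_t; rewrite -w_reads // nth_mkseq //.
  by rewrite size_mkseq in lt_j; apply: leq_trans lt_j; rewrite ltn_add2l.
- have [n [_ _ [ne _]]] := sP k; apply: ne.
  by rewrite size_mkseq sk.
Qed.

(** * Dodging in a triangle and in a claw *)

Lemma third_choice (T : eqType) (L : seq T) (x y : T) :
  uniq L -> 2 < size L -> exists m, [/\ m \in L, x != m & y != m].
Proof.
move=> uL; case: (boolP (all (mem [:: x; y]) L)) => [/allP sub | /allPn[m mL mN] _].
  by have := uniq_leq_size uL sub; rewrite /= leqNgt => /negbTE->.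
by exists m; move: mN; rewrite /= !inE negb_or eq_sym [m == y]eq_sym => /andP[].
Qed.

Lemma dodging_triangle (T : finType) (e : rel T) (a b c : T) :
  symmetric e -> uniq [:: a; b; c] -> e a b -> e b c -> e c a ->
  dodging e [:: a; b; c] (fun x _ u => u \in [:: a; b; c] /\ x != u).
Proof.
move=> e_sym abc ab bc ca x y z u [uH xu] _ _.
have adj v w : v \in [:: a; b; c] -> w \in [:: a; b; c] -> v != w -> e v w.
  by rewrite !inE => /or3P[] /eqP -> /or3P[] /eqP ->; rewrite ?eqxx // e_sym.
have [yu|yu] := eqVneq y u; last first.
  by exists [::]; split=> //; rewrite inE.
(* The vertex [x] may lie outside the triangle; [v] only has to differ from both [x] and [u]. *)
have [//|v [vH xv uv]] := third_choice x u abc.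
exists [:: v]; split.
- by rewrite /= andbT /induced_edge uH vH adj.
- by rewrite !inE negb_or xu.
- by rewrite yu.
Qed.

(** While the first token is at the centre, the second one cannot leave its leaf; hence the
    invariant looks one step ahead when [x = c]. *)
Lemma dodging_claw (T : finType) (e : rel T) (c l1 l2 l3 : T) :
  symmetric e -> irreflexive e -> uniq [:: l1; l2; l3] -> all (e c) [:: l1; l2; l3] ->
  dodging e [:: c; l1; l2; l3]
    (fun x y u => [/\ u \in [:: l1; l2; l3], x != u & x = c -> y != u]).
Proof.
set L := [:: l1; l2; l3] => e_sym e_irr uL /allP adj x y z u [uL' xu xc] exy eyz.
have cL v : v \in L -> c != v.
  by move=> /adj; apply: contraTneq => <-; rewrite e_irr.
have [xcE|xNc] := eqVneq x c.
  exists [::]; split=> //; first by rewrite inE.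
  split=> [//||yc]; first exact: xc.
  by move: exy; rewrite xcE yc e_irr.
(* Only two vertices have to be avoided: [x] and [z] if [y = c], since leaves differ from [c], and
   [x] and [y] otherwise. *)
have [m [mL xm [ym zm]]] : exists m, [/\ m \in L, x != m & y != m /\ (y = c -> z != m)].
  have [yc|ync] := eqVneq y c.
    by have [//|m [mL xm zm]] := third_choice x z uL; exists m; rewrite yc cL.
  have [//|m [mL xm ym]] := third_choice x y uL; exists m; split=> //; split=> // yc.
  by rewrite yc eqxx in ync.
exists [:: c; m]; split=> //; last by rewrite !inE !negb_or xu xNc.
by rewrite /= /induced_edge !(in_cons c L) eqxx uL' mL !orbT /= e_sym !adj.
Qed.

(** * Graphs of maximal degree two *)

(* A longest simple path is Hamiltonian: an outside neighbour would extend it at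
   an end or give an inner vertex a third neighbour. *)
Lemma hamiltonian_path (T : finType) (e : rel T) :
  symmetric e -> connected_graph e -> (forall x, degree e x <= 2) ->
  exists x p, [/\ path e x p, uniq (x :: p) & forall y, y \in x :: p].
Proof.
move=> e_sym [/card_gt0P[x0 _] e_conn] deg2.
pose simple n := [exists t : n.-tuple T, sorted e t && uniq t].
have simple1 : exists n, simple n.
  by exists 1; apply/existsP; exists [tuple x0].
have simple_le n : simple n -> n <= #|T|.
  by case/existsP=> t /andP[_ /card_uniqP]; rewrite size_tuple => <-; apply: max_card.
case: (ex_maxnP simple1 simple_le) => n /existsP[t /andP[t_sorted t_uniq]] n_max.
have too_long s : sorted e s -> uniq s -> size s <= n.
  move=> s_sorted s_uniq; apply: n_max; apply/existsP; exists (in_tuple s).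
  by rewrite s_sorted.
have n_gt0 : 0 < n by apply: n_max; apply/existsP; exists [tuple x0].
case: t t_sorted t_uniq => -[|x p] /=; first by move/eqP=> n0; rewrite -n0 in n_gt0.
move=> /eqP sz p_path /andP[xp p_uniq].
have u_xp : uniq (x :: p) by rewrite /= xp.
exists x, p; split=> // y; apply: contraT => y_out.
(* By connectedness some edge leaves the vertex set of the path. *)
have [v [w [v_in w_out vw]]] : exists v w, [/\ v \in x :: p, w \notin x :: p & e v w].
  have /connectP[q q_path yE] := e_conn x y; rewrite {}yE in y_out.
  have exits q' x' : x' \in x :: p -> path e x' q' -> last x' q' \notin x :: p ->
      exists v w, [/\ v \in x :: p, w \notin x :: p & e v w].
    elim: q' x' => [|z q' IHq] x' x'_in /=; first by rewrite x'_in.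
    case/andP=> x'z q'_path; have [z_in|z_out] := boolP (z \in x :: p).
      exact: IHq.
    by exists x', z.
  exact: exits (mem_head _ _) q_path y_out.
have [i lt_i vE] : exists2 i, i < size (x :: p) & v = nth x (x :: p) i.
  by exists (index v (x :: p)); rewrite ?index_mem // nth_index.
have nth_edge k : k.+1 < size (x :: p) -> e (nth x (x :: p) k) (nth x (x :: p) k.+1).
  by move: k; apply/(pathP x).
case: i lt_i vE => [|i] lt_i vE.
  have := too_long (w :: x :: p); rewrite /= e_sym -[x in e x w]vE.
  by rewrite vw p_path w_out xp p_uniq sz ltnn => /(_ isT isT).
have [lt_i2|ge_i2] := ltnP i.+2 (size (x :: p)); last first.
  have lastE : last x p = v.
    by rewrite vE -(nth_last x) /=; congr nth; move: lt_i ge_i2 => /=; lia.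
  have := too_long (rcons (x :: p) w); rewrite rcons_uniq u_xp w_out size_rcons.
  by rewrite /= rcons_path p_path lastE vw sz ltnn => /(_ isT isT).
have := deg2 v; rewrite leqNgt => /negP[]; apply/card_gt2P.
exists (nth x (x :: p) i), (nth x (x :: p) i.+2), w; split; split.
- by rewrite inE e_sym vE; apply: nth_edge; apply: ltnW.
- by rewrite inE vE; apply: nth_edge.
- by rewrite inE.
- by rewrite nth_uniq //; [lia | apply: ltnW; apply: ltnW].
- by apply: contraNneq w_out => <-; rewrite mem_nth.
- by apply: contraNneq w_out => ->; rewrite mem_nth // ltnW // ltnW.
Qed.

Lemma isomorphic_index (T : finType) (e : rel T) (x0 : T) (t : seq T) n (e' : rel 'I_n) :
  uniq t -> (forall y, y \in t) -> size t = n ->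
  (forall i j : 'I_n, e' i j = e (nth x0 t i) (nth x0 t j)) ->
  graph_isomorphic e e'.
Proof.
move=> t_uniq t_all sz ee'.
have lt_index y : index y t < n by rewrite -sz index_mem.
exists (fun y => Ordinal (lt_index y)) => [|x y]; last first.
  by rewrite ee' /= !nth_index.
apply: inj_card_bij => [x y [] /(congr1 (nth x t))|]; first by rewrite !nth_index.
rewrite card_ord -sz -(card_uniqP t_uniq); exact: max_card.
Qed.

(** Along a Hamiltonian path, an edge between non-consecutive vertices must join the two ends, since
    an inner endpoint would have a third neighbour. That edge decides between cycle and path. *)
Lemma degree_le2_path_or_cycle (T : finType) (e : rel T) :
  simple_graph e -> connected_graph e -> (forall x, degree e x <= 2) ->
  is_path_graph e \/ is_cycle_graph e.
Proof.
move=> [e_sym e_irr] e_conn deg2.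
have [x [p [p_path t_uniq t_all]]] := hamiltonian_path e_sym e_conn deg2.
have [n nE] : exists n, size (x :: p) = n by exists (size (x :: p)).
pose v i := nth x (x :: p) i.
have v_edge i : i.+1 < n -> e (v i) (v i.+1).
  by rewrite -nE; move: i; apply/(pathP x).
have v_inj i j : i < n -> j < n -> (v i == v j) = (i == j).
  by move=> lt_i lt_j; rewrite nth_uniq ?nE.
have three i j k l : l < n -> i < j -> j < k -> k < n ->
    e (v l) (v i) -> e (v l) (v j) -> e (v l) (v k) -> False.
  move=> lt_l ij jk kn li lj lk; have := deg2 (v l); rewrite leqNgt => /negP[].
  by apply/card_gt2P; exists (v i), (v j), (v k); split; split; rewrite ?inE ?v_inj //; lia.
have vE i j : i < j < n ->
    e (v i) (v j) = (j == i.+1) || [&& i == 0, j == n.-1 & e (v 0) (v n.-1)].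
  move=> /andP[ij jn]; apply/idP/orP => [eij|[/eqP->|/and3P[/eqP-> /eqP->]]] //;
    last by apply: v_edge; lia.
  have [->|ne] := eqVneq j i.+1; [by left|right].
  case: i => [|i] in ij eij ne *.
    have [jE|nej] := eqVneq j n.-1; first by rewrite eqxx -jE.
    (* The inner vertex [j] would have the neighbours [0], [j.-1] and [j.+1]; in the other case
       [i.+1] would have [i], [i.+2] and [j]. *)
    exfalso; apply: (three 0 j.-1 j.+1 j); rewrite ?[e (v j) (v 0)]e_sym //; try lia.
      have jE : j = j.-1.+1 by lia.
      by rewrite e_sym {2}jE; apply: v_edge; lia.
    by apply: v_edge; lia.
  exfalso; apply: (three i i.+2 j i.+1) => //; try lia.
    by rewrite e_sym; apply: v_edge; lia.
  by apply: v_edge; lia.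
have wlog_lt (e' : rel 'I_n) : symmetric e' -> irreflexive e' ->
    (forall i j : 'I_n, i < j -> e' i j = e (v i) (v j)) -> graph_isomorphic e e'.
  move=> s' i' e'E; apply: (isomorphic_index (x0 := x)) t_uniq t_all nE _ => i j.
  rewrite -/(v i) -/(v j).
  case: (ltngtP i j) => [||/val_inj->]; first exact: e'E.
    by rewrite s' e_sym; exact: e'E.
  by rewrite i' e_irr.
(* For [n = 2] the edge between the ends is the path edge itself, hence the guard. *)
have [chord|no_chord] := boolP ((2 < n) && e (v 0) (v n.-1)).
  case/andP: chord => n_gt2 chord.
  right; exists n => //; apply: wlog_lt => [i j|i|i j ij].
  - by rewrite /cycle_rel orbC.
  - rewrite /cycle_rel orbb; apply/negbTE/negP => /eqP /=.
    have lt_i := ltn_ord i; have [lt_i1|ge_i1] := ltnP i.+1 n.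
      by rewrite modn_small //; lia.
    have iE : i.+1 = n by lia.
    by rewrite iE modnn; lia.
  have lt_j := ltn_ord j; rewrite vE ?ij // chord andbT /cycle_rel /=.
  rewrite (modn_small (m := i.+1)); last by lia.
  rewrite eq_sym; congr (_ || _); have [lt_j1|ge_j1] := ltnP j.+1 n.
    by rewrite modn_small //; lia.
  have jE : j.+1 = n by lia.
  by rewrite jE modnn; lia.
left; exists n; apply: wlog_lt => [i j|i|i j ij].
- by rewrite /path_rel orbC.
- by rewrite /path_rel orbb; lia.
have lt_j := ltn_ord j; rewrite vE ?ij // /path_rel /= eq_sym.
have -> : (j.+1 == i) = false by lia.
rewrite orbF; case: eqP => //= ne; apply/esym/negbTE; apply: contraNN no_chord.
by case/and3P=> /eqP i0 /eqP jE ->; rewrite andbT; lia.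
Qed.

(** * Evadable vertices *)

(* The sequence [bad] is what the diagonal argument against countability avoids. *)
Definition evadable (T : finType) (e : rel T) (p : T) : Prop :=
  forall bad : nat -> nat -> T, exists s,
    [/\ is_walk e s, forall k, s <> bad k
      & forall r, is_walk e r -> r 0 = p -> (forall N, exists2 i, N <= i & r i = p) ->
          successful r s].

Lemma dodging_evadable (T : finType) (e : rel T) (H : seq T) I (p h a b : T) :
  dodging e H I -> (forall y, exists2 u, u \in H & I p y u) -> p \notin H ->
  symmetric e -> (forall x, x \in H -> x != h -> connect (induced_edge H e) h x) ->
  a != b -> induced_edge H e h a -> induced_edge H e h b -> evadable e p.
Proof.
move=> dI I0 pH e_sym h_conn ab ha hb bad.
have g_sym : connect_sym (induced_edge H e).
  by apply: sym_connect_sym => x y; rewrite /induced_edge e_sym; case: (x \in H); case: (y \in H).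
have h_conn' x : x \in H -> connect (induced_edge H e) h x.
  by move=> xH; have [->|] := eqVneq x h; [exact: connect0 | exact: h_conn].
have [|s [s_walk sH s_univ s_bad]] := universal_walk_avoiding bad _ ab ha hb.
  move=> x y xH yH; apply: connect_trans (h_conn' _ yH).
  by rewrite g_sym; exact: h_conn'.
exists s; split=> // r r_walk r0 r_p.
exact: universal_successful dI I0 pH r_walk r0 r_p sH s_univ.
Qed.

Lemma triangle_evadable (T : finType) (e : rel T) (a b c p : T) :
  simple_graph e -> e a b -> e b c -> e c a -> p \notin [:: a; b; c] -> evadable e p.
Proof.
move=> [e_sym e_irr] ab bc ca pH.
have neq x y : e x y -> x != y by apply: contraTneq => ->; rewrite e_irr.
have abc : uniq [:: a; b; c].
  by rewrite /= !inE negb_or !neq // e_sym.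
apply: (dodging_evadable (h := a) (a := b) (b := c) (dodging_triangle e_sym abc ab bc ca)) => //.
- by move=> y; exists a; rewrite !inE eqxx //; split=> //; move: pH; rewrite !inE; case: eqP.
- move=> x xH xa; apply: connect1; rewrite /induced_edge xH mem_head /=.
  by move: xH xa; rewrite !inE => /or3P[] /eqP->; rewrite ?eqxx // e_sym.
- exact: neq.
- by rewrite /induced_edge !inE !eqxx !orbT.
- by rewrite /induced_edge !inE !eqxx !orbT e_sym.
Qed.

Lemma claw_evadable (T : finType) (e : rel T) (c l1 l2 l3 p : T) :
  simple_graph e -> uniq [:: l1; l2; l3] -> all (e c) [:: l1; l2; l3] ->
  p \notin [:: c; l1; l2; l3] -> evadable e p.
Proof.
move=> [e_sym e_irr] ul adj pH.
apply: (dodging_evadable (h := c) (a := l1) (b := l2) (dodging_claw e_sym e_irr ul adj)) => //.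
- move=> y; have [//|m [mL pm ym]] := third_choice p y ul.
  by exists m; [rewrite inE mL orbT | split].
- move=> x xH xc; apply: connect1; rewrite /induced_edge xH mem_head /=.
  by move: xH; rewrite inE (negbTE xc) => /(allP adj).
- by move: ul; rewrite /= inE negb_or; case: (l1 == l2).
- by rewrite /induced_edge !inE !eqxx !orbT /=; case/and3P: adj.
- by rewrite /induced_edge !inE !eqxx !orbT /=; case/and4P: adj.
Qed.

Lemma exists_evadable (T : finType) (e : rel T) :
  simple_graph e -> connected_graph e ->
  ~ is_path_graph e -> ~ is_cycle_graph e -> ~ is_claw e -> exists p, evadable e p.
Proof.
move=> e_simple e_conn not_path not_cycle not_claw; have [e_sym e_irr] := e_simple.
have [c deg3] : exists c, 2 < degree e c.
  have [/forallP deg2|] := boolP [forall x, degree e x <= 2].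
    by have [] := degree_le2_path_or_cycle e_simple e_conn deg2.
  by case/forallPn=> c; rewrite -ltnNge; exists c.
case/card_gt2P: deg3 => l1 [l2 [l3 [[c1 c2 c3] [n12 n23 n31]]]].
rewrite !inE in c1 c2 c3.
have ul : uniq [:: l1; l2; l3] by rewrite /= !inE negb_or n12 n23 eq_sym n31.
have neq x y : e x y -> x != y by apply: contraTneq => ->; rewrite e_irr.
have adj : all (e c) [:: l1; l2; l3] by rewrite /= c1 c2 c3.
have [all_in|] := boolP [forall p, p \in [:: c; l1; l2; l3]]; last first.
  by case/forallPn=> p; exists p; exact: claw_evadable adj _.
(* An edge between two leaves closes a triangle with [c], and the third leaf lies outside it. *)
have [e12|n12'] := boolP (e l1 l2).
  exists l3; apply: (triangle_evadable e_simple c1 e12); first by rewrite e_sym.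
  by rewrite !inE !negb_or [l3 == c]eq_sym neq // n31 eq_sym.
have [e23|n23'] := boolP (e l2 l3).
  exists l1; apply: (triangle_evadable e_simple c2 e23); first by rewrite e_sym.
  by rewrite !inE !negb_or [l1 == c]eq_sym neq // n12 eq_sym.
have [e31|n31'] := boolP (e l3 l1).
  exists l2; apply: (triangle_evadable e_simple c3 e31); first by rewrite e_sym.
  by rewrite !inE !negb_or [l2 == c]eq_sym neq // n23 eq_sym.
case: not_claw; apply: (@isomorphic_index _ _ c [:: c; l1; l2; l3]) => //.
- by rewrite cons_uniq ul andbT !inE !negb_or !neq.
- exact/forallP.
- have [c1' c2' c3'] : [/\ e l1 c, e l2 c & e l3 c] by rewrite ![e _ c]e_sym.
  move=> [[|[|[|[|i]]]] // lt_i] [[|[|[|[|j]]]] // lt_j];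
  by rewrite /claw_rel /= ?e_irr ?c1 ?c2 ?c3 ?c1' ?c2' ?c3' ?(negbTE n12') ?(negbTE n23')
    ?(negbTE n31') // e_sym ?(negbTE n12') ?(negbTE n23') ?(negbTE n31').
Qed.

(** * Recurrence of the random walk *)

Local Open Scope classical_set_scope.
Local Open Scope ring_scope.

Definition cylinder (T : finType) (Omega : Type) (X : nat -> Omega -> T)
    (n : nat) (w : nat -> T) : set Omega :=
  [set om | forall i, (i <= n)%N -> X i om = w i].

Definition avoids_between (T : finType) (Omega : Type) (X : nat -> Omega -> T)
    (p : T) (N n : nat) : set Omega :=
  [set om | forall i, (N <= i <= n)%N -> X i om <> p].

Section RandomWalk.
Context (R : realType) (T : finType) (e : rel T) (d : measure_display).
Context (Omega : measurableType d) (P : probability Omega R) (X : nat -> Omega -> T).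
Context (X_walk : random_walk e P X) (e_conn : connected_graph e).

Lemma measurable_event (n : nat) (A : set T) : measurable [set om | A (X n om)].
Proof.
have [mX _ _] := X_walk.
have -> : [set om | A (X n om)] = \bigcup_(x in A) [set om | X n om = x].
  by apply/seteqP; split => [om Aom|om [x Ax /= ->]] //; exists (X n om).
by apply: fin_bigcup_measurable => // x _; exact: mX.
Qed.

Lemma measurable_cylinder n w : measurable (cylinder X n w).
Proof.
have -> : cylinder X n w = \bigcap_(i in [set i | (i <= n)%N]) [set om | X i om = w i].
  by apply/seteqP; split => om.
by apply: bigcap_measurableType => i _; exact: (measurable_event i [set w i]).
Qed.

Lemma measurable_avoids p N n : measurable (avoids_between X p N n).
Proof.
have -> : avoids_between X p N n =
    \bigcap_(i in [set i | (N <= i <= n)%N]) [set om | X i om <> p].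
  by apply/seteqP; split => om.
by apply: bigcap_measurableType => i _; exact: (measurable_event i [set x | x <> p]).
Qed.

(** The cylinders of a given length form a finite partition once indexed by the finite functions on
    ['I_n.+1], so the inequality is summed over them. *)
Lemma probability_le_cylinders n (c : R) (A B : set Omega) :
  measurable A -> measurable B ->
  (forall w, P (A `&` cylinder X n w) <= c%:E * P (B `&` cylinder X n w))%E ->
  (P A <= c%:E * P B)%E.
Proof.
move=> mA mB AB.
pose C (f : {ffun 'I_n.+1 -> T}) := cylinder X n (fun i => f (inord i)).
have split_C D : measurable D -> (P D = \sum_(f \in [set: {ffun 'I_n.+1 -> T}]) P (D `&` C f))%E.
  move=> mD; rewrite -measure_fin_bigcup //.
  - congr (P _); apply/seteqP; split => [om Dom|om [f _ []]//].
    exists [ffun i : 'I_n.+1 => X i om] => //; split=> // i le_i /=.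
    by rewrite ffunE inordK.
  - exact: finite_finset.
  - move=> f g _ _ [om [[_ fom] [_ gom]]]; apply/ffunP => i.
    have := fom i (ltn_ord i); rewrite (gom i (ltn_ord i)).
    by rewrite inord_val.
  - by move=> f _; apply: measurableI => //; exact: measurable_cylinder.
rewrite !split_C // ge0_mule_fsumr //.
by apply: lee_fsum => [|f _]; [exact: finite_finset | exact: AB].
Qed.

(** A lower bound for the transition probability along any edge, as degrees are at most [#|T|]. *)
Let kappa : R := (#|T|%:R)^-1.

Lemma kappa_range : 0 < kappa <= 1.
Proof.
have [T_gt0 _] := e_conn.
by rewrite /kappa invr_gt0 ltr0n T_gt0 /= invf_le1 ?ltr0n // ler1n.
Qed.

Lemma probability_cylinder_extend n k w :
  (forall i, (n <= i < n + k)%N -> e (w i) (w i.+1)) ->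
  ((kappa ^+ k)%:E * P (cylinder X n w) <= P (cylinder X (n + k) w))%E.
Proof.
have [_ _ cyl] := X_walk; have /andP[k0 k1] := kappa_range.
elim: k => [|k IHk] w_edge; first by rewrite addn0 expr0 mul1e.
rewrite addnS [leRHS](cyl (n + k)%N w) w_edge; last by rewrite leq_addr addnS ltnSn.
rewrite exprSr EFinM -muleA muleCA muleC; apply: lee_pmul => //.
- by rewrite mule_ge0 // lee_fin exprn_ge0 // ltW.
- by rewrite lee_fin ltW.
- by apply: IHk => i /andP[ni ik]; apply: w_edge; rewrite ni addnS ltnW.
- rewrite lee_fin lef_pV2 ?posrE ?ltr0n ?ler_nat ?max_card //.
    by have [] := e_conn.
  apply/card_gt0P; exists (w (n + k).+1); rewrite inE; apply: w_edge.
  by rewrite leq_addr addnS ltnSn.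
Qed.

(** From any vertex, [p] is reached by a path of at most [#|T|] edges, which the walk follows with
    conditional probability at least [kappa ^+ #|T|]. *)
Lemma probability_avoids_step p N n : (N <= n)%N ->
  (P (avoids_between X p N (n + #|T|))
     <= (1 - kappa ^+ #|T|)%:E * P (avoids_between X p N n))%E.
Proof.
move=> le_N; have /andP[k0 k1] := kappa_range.
have k_le1 : kappa ^+ #|T| <= 1 by rewrite exprn_ile1 // ltW.
apply: (@probability_le_cylinders n); try exact: measurable_avoids.
move=> w; have [visit|no_visit] := pselect (exists2 i, (N <= i <= n)%N & w i = p).
  have [i /andP[Ni ni] wi] := visit.
  have -> : avoids_between X p N (n + #|T|) `&` cylinder X n w = set0.
    apply/seteqP; split=> // om [av cy]; apply: (av i); last by rewrite cy.
    by rewrite Ni (leq_trans ni) ?leq_addr.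
  by rewrite measure0 mule_ge0 // lee_fin subr_ge0.
have -> : avoids_between X p N n `&` cylinder X n w = cylinder X n w.
  apply/setIidr => om cy i /andP[Ni ni] Xp; apply: no_visit.
  by exists i; rewrite ?Ni // -cy.
have [q [q_path q_last q_size]] : exists q, [/\ path e (w n) q, last (w n) q = p &
    (size q <= #|T|)%N].
  have [_ /(_ (w n) p) /connectP[q q_path ->]] := e_conn.
  have [q' q'_path q'_uniq _] := shortenP q_path; exists q'; split=> //.
  by have := max_card (mem (w n :: q')); rewrite (card_uniqP q'_uniq) => /ltnW.
(* The history [w] is prolonged by the path [q] from [w n] to [p]; avoiding [p] forces the walk off
   [w']. *)
pose w' i := if (i <= n)%N then w i else nth p (w n :: q) (i - n).
have w'E : cylinder X n w = cylinder X n w'.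
  by apply/seteqP; split=> om cy i le_i; rewrite cy // /w' le_i.
have w'n i : w' (n + i)%N = nth p (w n :: q) i.
  rewrite /w'; case: i => [|i]; first by rewrite addn0 leqnn.
  by rewrite addnS ltnNge leq_addr /= -addnS addKn.
have w'_edge i : (n <= i < n + size q)%N -> e (w' i) (w' i.+1).
  move=> /andP[ni iq]; rewrite -(subnKC ni) -addnS !w'n.
  by move/(pathP p): q_path; apply; rewrite ltn_subLR.
have mC m v := measurable_cylinder m v.
have sub : avoids_between X p N (n + #|T|) `&` cylinder X n w `<=`
    cylinder X n w' `\` cylinder X (n + size q) w'.
  move=> om [av]; rewrite w'E => cy; split=> // cy'.
  apply: (av (n + size q)%N).
    by rewrite (leq_trans le_N) ?leq_addr // leq_add2l.
  by rewrite cy' // w'n nth_last.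
apply: le_trans (le_measure P _ _ sub) _; rewrite ?inE.
- by apply: measurableI; [exact: measurable_avoids | exact: mC].
- by apply: measurableD; exact: mC.
rewrite w'E measureD ?ltey_eq ?fin_num_measure //.
rewrite setIidr => [|om cy i le_i]; last by rewrite cy // (leq_trans le_i) ?leq_addr.
have := probability_cylinder_extend w'_edge.
have [c c_ge0 cE] : exists2 c, 0 <= c & P (cylinder X n w') = c%:E.
  by exists (fine (P (cylinder X n w'))); rewrite ?fine_ge0 // fineK ?fin_num_measure.
have [c' c'E] : exists c', P (cylinder X (n + size q) w') = c'%:E.
  by exists (fine (P (cylinder X (n + size q) w'))); rewrite fineK ?fin_num_measure.
rewrite cE c'E -EFinM lee_fin => le_c'.
apply: (@le_trans _ _ (c%:E - c'%:E)%E); first by rewrite -cE -c'E.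
rewrite -EFinB -EFinM lee_fin.
have le_k : kappa ^+ #|T| <= kappa ^+ size q by rewrite ler_wiXn2l // ltW.
by have := ler_wpM2r c_ge0 le_k; lra.
Qed.

(** Successive blocks of [#|T|] steps each contribute a factor [r < 1], so the probability lies
    below every [r ^+ k]. *)
Lemma eventually_avoids_negligible p N :
  P.-negligible [set om | forall i, (N <= i)%N -> X i om <> p].
Proof.
have /andP[k0 k1] := kappa_range.
have mE : measurable [set om | forall i, (N <= i)%N -> X i om <> p].
  have -> : [set om | forall i, (N <= i)%N -> X i om <> p] =
      \bigcap_(i in [set i | (N <= i)%N]) [set om | X i om <> p].
    by apply/seteqP; split => om.
  by apply: bigcap_measurableType => i _; exact: (measurable_event i [set x | x <> p]).
set r := 1 - kappa ^+ #|T|.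
have r_ge0 : 0 <= r by rewrite subr_ge0 exprn_ile1 // ltW.
have r_lt1 : r < 1 by rewrite /r; have := exprn_gt0 #|T| k0; lra.
have bound k : (P [set om | forall i, (N <= i)%N -> X i om <> p] <= (r ^+ k)%:E)%E.
  apply: (@le_trans _ _ (P (avoids_between X p N (N + k * #|T|)))).
    apply: le_measure; rewrite ?inE //; first exact: measurable_avoids.
    by move=> om av i /andP[/av].
  elim: k => [|k IHk]; first by rewrite expr0 probability_le1 //; exact: measurable_avoids.
  rewrite mulSn addnCA addnC; apply: le_trans (probability_avoids_step _ _) _.
    exact: leq_addr.
  by rewrite exprS EFinM lee_pmul // lee_fin.
apply/negligibleP => //; apply/eqP; rewrite eq_le measure_ge0 andbT.
have [c cE] : exists c, P [set om | forall i, (N <= i)%N -> X i om <> p] = c%:E.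
  eexists; rewrite -[LHS]fineK ?fin_num_measure //.
apply: (@le_trans _ _ c%:E); first by rewrite -cE.
rewrite lee_fin leNgt; apply/negP => c_gt0.
have r_norm : `|r| < 1 by rewrite ger0_norm.
have /cvgrPdist_lt/(_ _ c_gt0) := cvg_expr r_norm.
move=> [k _ /(_ k (leqnn k))] /=; rewrite sub0r normrN ger0_norm ?exprn_ge0 //.
by have := bound k; rewrite cE lee_fin leNgt => /negbTE->.
Qed.

Lemma non_edge_negligible n : P.-negligible [set om | ~~ e (X n om) (X n.+1 om)].
Proof.
have [_ _ cyl] := X_walk.
have mE : measurable [set om | ~~ e (X n om) (X n.+1 om)].
  have -> : [set om | ~~ e (X n om) (X n.+1 om)] =
      \bigcup_(x in [set: T]) ([set om | X n om = x] `&` [set om | ~~ e x (X n.+1 om)]).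
    by apply/seteqP; split=> [om ne|om [x _ [/= <-]]] //; exists (X n om).
  apply: fin_bigcup_measurable => // x _; apply: measurableI.
    exact: (measurable_event n [set x]).
  exact: (measurable_event n.+1 [set y | ~~ e x y]).
apply/negligibleP => //; apply/eqP; rewrite eq_le measure_ge0 andbT.
(* The comparison over cylinders is used with constant [0] against the whole space. *)
rewrite -(mul0e (P setT)); apply: (@probability_le_cylinders n.+1) => // w.
rewrite mul0e; have [ew|new] := boolP (e (w n) (w n.+1)).
  rewrite (_ : _ `&` _ = set0) ?measure0 //; apply/seteqP; split=> // om [ne cy].
  by move: ne; rewrite /= !cy // ew.
apply: (@le_trans _ _ (P (cylinder X n.+1 w))).
  apply: le_measure; rewrite ?inE //; last exact: measurable_cylinder.
  by apply: measurableI => //; exact: measurable_cylinder.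
by rewrite [leLHS](cyl n w) (negbTE new) mule0.
Qed.

(** The event that [X] starts at [p] has probability [1 / #|T|]; a null set containing all failures
    of adjacency or of recurrence is removed from it. *)
Lemma recurrent_from p : exists A : set Omega, [/\ measurable A, (0 < P A)%E &
  forall om, A om -> [/\ is_walk e (X ^~ om), X 0%N om = p &
    forall N, exists2 i, (N <= i)%N & X i om = p]].
Proof.
have [mX X0 _] := X_walk; have [T_gt0 _] := e_conn.
have [B [mB PB subB]] : P.-negligible
    ((\bigcup_n [set om | ~~ e (X n om) (X n.+1 om)]) `|`
     \bigcup_N [set om | forall i, (N <= i)%N -> X i om <> p]).
  apply: negligibleU; apply: negligible_bigcup => n.
    exact: non_edge_negligible.
  exact: eventually_avoids_negligible.
exists ([set om | X 0%N om = p] `\` B); split; first exact: measurableD.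
- rewrite measureD ?ltey_eq ?fin_num_measure //.
  rewrite [X in (_ - X)%E](_ : _ = 0%E); last first.
    apply/eqP; rewrite eq_le measure_ge0 andbT -PB.
    by apply: le_measure; rewrite ?inE //; exact: measurableI.
  by rewrite sube0 [ltRHS]X0 lte_fin invr_gt0 ltr0n.
- move=> om [Xp nB]; split=> // [i|N].
    apply: contraT => ne; case: nB; apply: subB; left; exists i => //.
  have [//|no] := pselect (exists2 i, (N <= i)%N & X i om = p).
  case: nB; apply: subB; right; exists N => // i Ni Xi; apply: no.
  by exists i.
Qed.

End RandomWalk.

(** * Uncountability by diagonalisation *)

Theorem theorem2p5 (R : realType) (T : finType) (e : rel T)
  (e_simple : simple_graph e) (e_connected : connected_graph e)
  (not_path : ~ is_path_graph e) (not_cycle : ~ is_cycle_graph e)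
  (not_claw : ~ is_claw e) :
  ~ countable [set S : nat -> T | evasive e R S].
Proof.
move=> /countable_injP[code code_inj].
have [p evadable_p] := exists_evadable e_simple e_connected not_path not_cycle not_claw.
pose bad k : nat -> T :=
  if pselect (exists S, evasive e R S /\ code S = k) is left ex then sval (cid ex)
  else fun=> p.
have [s [s_walk s_bad s_succ]] := evadable_p bad.
have s_evasive : evasive e R s.
  split=> // d Omega P X X_walk.
  have [A [mA PA AP]] := recurrent_from X_walk e_connected p.
  by exists A; split=> // om /AP[]; exact: s_succ.
apply: (s_bad (code s)); rewrite /bad; case: pselect => [ex|[]]; last by exists s.
case: (cid ex) => S [S_evasive code_S] /=.
by apply: code_inj; rewrite ?inE.
Qed.
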